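(* Let $A=[a_{ij}]$ be an $n\times n$ real matrix with non-negative entries and let $\lambda\in\mathbb{C}$ be an eigenvalue of $A$ with geometric multiplicity at least two. For each $i\in\{1,\dots,n\}$ let $r_i$ denote the sum of the $\lfloor n/2\rfloor$ largest terms (counted with repetition) among the $n-1$ off-diagonal entries $a_{ij}$, $j\neq i$, of the $i$-th row of $A$. Then there exists $i\in\{1,\dots,n\}$ such that $\lambda\in D(a_{ii},r_i)$, that is, $|\lambda-a_{ii}|\le r_i$.
   Context: For $a\in\mathbb{C}$ and $r\ge 0$, $D(a,r)=\{x\in\mathbb{C}: |x-a|\le r\}$ is the closed disk in the complex plane. The disks $D(a_{ii},r_i)$ are called the half Gershgorin disks of $A$. The geometric multiplicity of an eigenvalue $\lambda$ of $A$ is the dimension of the corresponding eigenspace (over $\mathbb{C}$), i.e. of the kernel of $A-\lambda I$. *)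

(* Defs.v *)
From mathcomp Require Export all_boot all_order all_algebra.
From mathcomp Require Export complex reals.

Set Implicit Arguments.
Unset Strict Implicit.
Unset Printing Implicit Defensive.

Export Order.TTheory GRing.Theory Num.Theory.
Local Open Scope ring_scope.
Local Open Scope complex_scope.

Definition complex_mx (R : realType) (n : nat) (A : 'M[R]_n) : 'M[R[i]]_n :=
  map_mx (real_complex R) A.

(* MathComp's [eigenvalue] and [eigenspace] are about row vectors u with
   u *m M = l *: u.  The transpose turns this into the column convention:
   u lies in [eigenspace M^T l] iff M *m u^T = l *: u^T. *)
Definition is_eigenvalue (F : fieldType) (n : nat) (M : 'M[F]_n) (l : F) : bool :=
  eigenvalue M^T l.

Definition geom_mult (F : fieldType) (n : nat) (M : 'M[F]_n) (l : F) : nat :=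
  \rank (eigenspace M^T l).

(* The modulus `|_| on R[i] is itself R[i]-valued (with zero imaginary part),
   hence the embedding of the radius; the order on R[i] restricts to the usual
   one on real numbers. *)
Definition closed_disk (R : realType) (a : R[i]) (r : R) : pred R[i] :=
  [pred x | `|x - a| <= r%:C].

Definition off_diag_row (R : realType) (n : nat) (A : 'M[R]_n) (i : 'I_n) : seq R :=
  [seq A i j | j <- enum 'I_n & j != i].

(* If k exceeds the length of s, the whole list is summed; this never happens
   in [half_radius], where k = n./2 <= n.-1. *)
Definition sum_largest (R : realType) (k : nat) (s : seq R) : R :=
  \sum_(x <- take k (sort >=%R s)) x.

Definition half_radius (R : realType) (n : nat) (A : 'M[R]_n) (i : 'I_n) : R :=
  sum_largest n./2 (off_diag_row A i).

(* Main.v *)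
Require Import Defs.
From mathcomp Require Import lra zify.
Local Open Scope ring_scope.
Local Open Scope complex_scope.

(** The eigenspace has dimension at least two, so it meets the hyperplane of
    vectors with zero coordinate sum: there is an eigenvector [x] with
    [\sum_j x_j = 0] ([sum_zero_vector]).  Scale it so that a coordinate [x_i]
    of largest modulus equals 1 ([max_norm_coord]).  Row [i] of the eigenvector
    equation then reads [lambda - a_ii = z] with [z = \sum_(j != i) a_ij x_j],
    and it remains to bound [|z|].

    Rotate the plane so that [z] lies on the positive real axis, and let [y_j]
    be the real part of the rotated [x_j].  The entries [a_ij] are
    non-negative, so [|z| = \sum_(j != i) a_ij y_j] is at most
    [\sum_(j != i) a_ij y_j^+], where [y_j^+ = max(y_j, 0)].  The numbers [y_j]
    lie in [[-1, 1]] and their sum is zero, so the [y_j^+] add up to the same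
    amount as the negative parts.  This common sum is at most the number of
    positive [y_j] and at most the number of the other ones, and the smaller
    of these two numbers is at most [n/2] rounded down
    ([sum_pos_part_le_half]).

    So [|z|] is bounded by a combination of the [a_ij] whose weights lie in
    [[0, 1]] and have total at most [k = n./2]; such a combination is largest
    when the whole weight sits on the [k] largest entries
    ([weighted_sum_le_sum_largest]). *)

(** This is the dual certificate for the optimality of the [k] largest terms:
    with the threshold [t] placed at the largest term that is left out, only
    the chosen terms contribute to the sum of the [max (x - t) 0]. *)
Lemma sum_largest_threshold (R : realType) (k : nat) (s : seq R) :
  {in s, forall x, 0 <= x} ->
  exists2 t, 0 <= t &
    t * k%:R + \sum_(x <- s) Num.max (x - t) 0 <= sum_largest k s.
Proof.
move=> s_ge0; set s' := sort >=%R s.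
have s'_ge0 : {in s', forall x, 0 <= x} by move=> x; rewrite mem_sort => /s_ge0.
have s'_sorted : sorted >=%R s' by apply: sort_sorted => x y; rewrite /= le_total.
have s'_nth i j : (i <= j < size s')%N -> nth 0 s' j <= nth 0 s' i.
  case/andP=> le_ij lt_j; apply: (sorted_leq_nth _ _ 0 s'_sorted) => //.
  - by move=> x y z /= le_xy /le_trans; apply.
  - by move=> x /=.
  - exact: leq_ltn_trans lt_j.
(* The default value 0 is the right threshold when [s] has at most [k] terms:
   they are all chosen. *)
exists (nth 0 s' k).
  have [lt_k|le_k] := ltnP k (size s'); last by rewrite nth_default.
  by rewrite s'_ge0 ?mem_nth.
set t := nth 0 s' k; rewrite /sum_largest -/s'.
rewrite -(perm_big _ (permEl (perm_sort >=%R s))) -/s' /=.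
rewrite -{1}(cat_take_drop k s') big_cat /=.
have -> : \sum_(x <- drop k s') Num.max (x - t) 0 = 0.
  rewrite big_seq big1 // => x /(nthP 0) [j]; rewrite size_drop => lt_j <-.
  rewrite nth_drop; apply/max_idPr; rewrite subr_le0; apply: s'_nth.
  by rewrite leq_addr -ltn_subRL.
have -> : \sum_(x <- take k s') Num.max (x - t) 0 = \sum_(x <- take k s') (x - t).
  rewrite big_seq [RHS]big_seq; apply: eq_bigr => x /(nthP 0) [j lt_j <-].
  apply/max_idPl; rewrite subr_ge0.
  have [lt_k|le_k] := ltnP k (size s').
    move: lt_j; rewrite size_takel ?(ltnW lt_k)// => lt_j.
    by rewrite nth_take //; apply: s'_nth; rewrite ltnW.
  by rewrite /t nth_default // s'_ge0 // (mem_take (mem_nth 0 lt_j)).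
rewrite addr0 sumrB big_const_seq count_predT iter_addr_0 -[t *+ _]mulr_natr.
have [lt_k|le_k] := ltnP k (size s').
  by rewrite size_takel ?(ltnW lt_k) // addrC subrK.
by rewrite /t nth_default // !mul0r subr0 add0r.
Qed.

(** Weak duality: for a threshold [t >= 0] and a weight [w] in [[0, 1]],
    [a * w = t * w + (a - t) * w <= t * w + max (a - t) 0]; sum this over the
    list and use that the total weight is at most [k]. *)
Lemma weighted_sum_le_sum_largest (R : realType) (I : Type) (r : seq I)
    (a w : I -> R) (k : nat) :
  (forall j, 0 <= a j) -> (forall j, 0 <= w j <= 1) ->
  \sum_(j <- r) w j <= k%:R ->
  \sum_(j <- r) a j * w j <= sum_largest k [seq a j | j <- r].
Proof.
move=> a_ge0 w_01 sum_w.
have [|t t_ge0] := @sum_largest_threshold R k [seq a j | j <- r].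
  by elim: r {sum_w} => //= j r IH x; rewrite inE => /predU1P[->|/IH].
apply: le_trans; rewrite big_map.
apply: (@le_trans _ _ (t * (\sum_(j <- r) w j)
                       + \sum_(j <- r) Num.max (a j - t) 0)).
  rewrite mulr_sumr -big_split; apply: ler_sum => j _ /=.
  have /andP[w_ge0 w_le1] := w_01 j.
  by case: (leP (a j - t) 0) => le_at; nra.
by rewrite lerD2r ler_wpM2l.
Qed.

(** As the [y j] add up to zero, the sum of the positive parts is also the sum
    of the negative parts.  The first form bounds it by the number of positive
    [y j], the second by the number of the remaining ones.  Comparing with
    both counts, instead of halving the sum of the [`|y j|], is what gives the
    bound rounded down for odd [#|I|]. *)
Lemma sum_pos_part_le_half {R : realDomainType} {I : finType} {y : I -> R} :
  \sum_j y j = 0 -> (forall j, `|y j| <= 1) ->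
  \sum_j Num.max (y j) 0 <= (#|I|./2)%:R.
Proof.
move=> sum0 y_le1; set p := #|[pred j | 0 < y j]|.
have sum_le_card (z : I -> R) (Q : pred I) :
    (forall j, Num.max (z j) 0 <= (Q j)%:R) ->
    \sum_j Num.max (z j) 0 <= #|Q|%:R.
  move=> z_le; rewrite -sum1_card natr_sum [leRHS]big_mkcond /=.
  by apply: ler_sum => j _; have := z_le j; rewrite unfold_in; case: (Q j).
have P_le_p : \sum_j Num.max (y j) 0 <= p%:R.
  apply: sum_le_card => j /=; have := y_le1 j; rewrite ler_norml => /andP[_ ?].
  by case: ltP.
have P_le_q : \sum_j Num.max (y j) 0 <= #|[predC [pred j | 0 < y j]]|%:R.
  have -> : \sum_j Num.max (y j) 0 = \sum_j Num.max (- y j) 0.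
    transitivity (\sum_j y j + \sum_j Num.max (- y j) 0); last first.
      by rewrite sum0 add0r.
    rewrite -big_split; apply: eq_bigr => j _ /=.
    by case: (leP (y j)) => h; case: (leP (- y j)) => h'; lra.
  apply: sum_le_card => j /=; have := y_le1 j; rewrite ler_norml => /andP[? _].
  by rewrite inE; case: (ltP 0 (y j)) => h; case: (leP (- y j)) => h' /=; lra.
set q := #|_| in P_le_q; have pqE : (p + q = #|I|)%N by rewrite cardC.
have [le_p|lt_p] := leqP p (#|I|./2).
  by rewrite (le_trans P_le_p) // ler_nat.
by rewrite (le_trans P_le_q) // ler_nat; move: lt_p; rewrite -pqE; lia.
Qed.

(** A hyperplane cuts the dimension of a space by at most one. *)
Lemma sum_zero_vector {F : fieldType} {m n : nat} {E : 'M[F]_(m, n)} :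
  (1 < \rank E)%N ->
  exists v : 'rV[F]_n, [/\ (v <= E)%MS, v != 0 & \sum_j v 0 j = 0].
Proof.
move=> rkE; pose c : 'cV[F]_n := const_mx 1.
have capE := mxrank_mul_ker E c; have rk1 := rank_leq_col (E *m c).
have /rowV0Pn[v v_cap v_neq0] : (E :&: kermx c)%MS != 0.
  by rewrite -mxrank_eq0; lia.
exists v; split=> //; first by rewrite (submx_trans v_cap) ?capmxSl.
have /sub_kermxP/matrixP/(_ 0 0) : (v <= kermx c)%MS.
  by rewrite (submx_trans v_cap) ?capmxSr.
by rewrite !mxE => {2}<-; apply: eq_bigr => j _; rewrite mxE mulr1.
Qed.

Lemma max_norm_coord {F : numFieldType} {n : nat} {v : 'rV[F]_n} :
  v != 0 ->
  exists2 i, v 0 i != 0 & forall j, `|v 0 j / v 0 i| <= 1.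
Proof.
move=> /rV0Pn[i0 vi0].
have [//|j _|i _ i_max] := @real_arg_maxP F _ i0 predT (fun j => `|v 0 j|).
  exact: normr_real.
have vi_neq0 : v 0 i != 0.
  by rewrite -normr_gt0 (lt_le_trans _ (i_max i0 isT)) ?normr_gt0.
exists i => // j.
by rewrite normrM normfV ler_pdivrMr ?normr_gt0 // mul1r; exact: i_max.
Qed.

Lemma rotate_to_norm {F : numFieldType} (z : F) : exists2 c : F, `|c| = 1 & c * z = `|z|.
Proof.
have [->|z0] := eqVneq z 0; first by exists 1; rewrite ?normr1 ?normr0 ?mulr0.
exists (`|z| / z); last by rewrite divfK.
by rewrite normrM normfV normr_id divff ?normr_eq0.
Qed.

Lemma Re_sum {R : realType} (I : Type) (r : seq I) (P : pred I) (F : I -> R[i]) :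
  complex.Re (\sum_(j <- r | P j) F j) = \sum_(j <- r | P j) complex.Re (F j).
Proof. by apply: (big_morph (@complex.Re R)) => // -[a b] [c d]. Qed.

(** The Gershgorin estimate: the modulus of the off-diagonal sum is its real
    part after a rotation by [c], which reduces the bound to the real numbers
    [y j], the coordinates of the [x j] in the direction of the sum. *)
Lemma norm_off_diag_sum_le (R : realType) (n : nat) (A : 'M[R]_n) (i : 'I_n)
    (x : 'I_n -> R[i]) :
  (forall j, 0 <= A i j) -> (forall j, `|x j| <= 1) -> \sum_j x j = 0 ->
  `|\sum_(j | j != i) (A i j)%:C * x j| <= (half_radius A i)%:C.
Proof.
move=> A_ge0 x_le1 sum0; set z := \sum_(j | _) _.
have [c c1 cz] := rotate_to_norm z; pose y j := complex.Re (c * x j).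
have y_le1 j : `|y j| <= 1.
  rewrite -lecR (le_trans (normc_ge_Re _)) // normrM c1 mul1r; exact: x_le1.
have sumy : \sum_j y j = 0 by rewrite -Re_sum -mulr_sumr sum0 mulr0.
have normE : complex.Re `|z| = \sum_(j | j != i) A i j * y j.
  rewrite -cz mulr_sumr Re_sum; apply: eq_bigr => j _.
  by rewrite mulrCA /y; case: (c * x j) => a b /=; rewrite mul0r subr0.
rewrite -(RRe_real (normr_real z)) lecR normE.
apply: (@le_trans _ _ (\sum_(j | j != i) A i j * Num.max (y j) 0)).
  by apply: ler_sum => j _; rewrite ler_wpM2l // le_max lexx.
have enumE (F : 'I_n -> R) :
    \sum_(j | j != i) F j = \sum_(j <- [seq j <- enum 'I_n | j != i]) F j.
  by rewrite big_filter big_enum_cond.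
rewrite enumE; apply: weighted_sum_le_sum_largest => //.
  move=> j; rewrite le_max lexx orbT ge_max ler01 andbT.
  by have := y_le1 j; rewrite ler_norml => /andP[].
rewrite -enumE; have := sum_pos_part_le_half sumy y_le1; rewrite card_ord.
apply: le_trans; rewrite [leRHS](bigD1 i) //= lerDr.
by rewrite le_max lexx orbT.
Qed.

Theorem theorem1 (R : realType) (n : nat) (A : 'M[R]_n) (lambda : R[i])
    (A_ge0 : forall i j : 'I_n, 0 <= A i j)
    (lambda_eig : is_eigenvalue (complex_mx A) lambda)
    (lambda_mult : (2 <= geom_mult (complex_mx A) lambda)%N) :
  exists i : 'I_n, lambda \in closed_disk ((A i i)%:C) (half_radius A i).
Proof.
have [v [/eigenspaceP v_eig v_neq0 sum_v]] := sum_zero_vector lambda_mult.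
have [i vi_neq0 v_max] := max_norm_coord v_neq0.
exists i; rewrite inE.
have -> : lambda - (A i i)%:C = \sum_(j | j != i) (A i j)%:C * (v 0 j / v 0 i).
  have /matrixP/(_ 0 i) := v_eig; rewrite !mxE => eq_i.
  apply: (mulIf vi_neq0); rewrite mulrBl -eq_i (bigD1 i) //= !mxE.
  rewrite [v 0 i * _]mulrC addrAC subrr add0r mulr_suml; apply: eq_bigr => j _.
  by rewrite !mxE mulrC -mulrA divfK.
apply: norm_off_diag_sum_le => //.
by rewrite -mulr_suml sum_v mul0r.
Qed.
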